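(* Let $C\geq 1$ and let $S$ be a locally $C$-finite semilattice, i.e. $|\{y\in S : y\preceq f\}|\leq C$ for every $f\in S$. Let $\mathsf{Sch}:\mathcal{A}_S\to \ell^\infty(S)$ denote the Schützenberger representation of $S$. Then: (i) $\|\mathsf{Sch}(a)\|_1\leq C\|a\|$ for all $a\in\mathcal{A}_S$ (so that $\mathsf{Sch}$ takes values in $\ell^1(S)$); (ii) $\mathsf{Sch}:\mathcal{A}_S\to \mathsf{P}(S)$ is invertible, and $\|\mathsf{Sch}^{-1}(b)\|\leq 2^{C-1}\|b\|_1$ for all $b\in\mathsf{P}(S)$. In particular, $\mathcal{A}_S$ is biflat.
   Context: A semilattice is a commutative semigroup in which every element is idempotent; its canonical partial order is $e\preceq f \iff ef=e$. For a semilattice $S$, $\mathcal{A}_S$ denotes its $\ell^1$-convolution algebra: the Banach space $\ell^1(S)$ with canonical basis $(e_s)_{s\in S}$ and the bounded bilinear product determined by $e_se_t=e_{st}$. The Schützenberger representation of $S$ is the bounded linear map $\mathsf{Sch}:\mathcal{A}_S\to\ell^\infty(S)$ determined by $\mathsf{Sch}(e_t)=\mathbf{1}_{\{y\in S: y\preceq t\}}$ (indicator function) for $t\in S$; it is an algebra homomorphism for pointwise multiplication on $\ell^\infty(S)$. $\mathsf{P}(S)$ denotes the Banach space $\ell^1(S)$ (norm $\|\cdot\|_1$) equipped with pointwise multiplication. For a Banach algebra $A$, let $\pi:A\widehat{\otimes}A\to A$ be the bounded linear map with $\pi(a\otimes b)=ab$ ($\widehat\otimes$ is the projective tensor product), let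 $''$ denote second dual / second adjoint, and let $\kappa:A\to A''$ be the natural embedding. $A\widehat{\otimes}A$ is an $A$-bimodule via $a\cdot(b\otimes c)=ab\otimes c$, $(b\otimes c)\cdot a=b\otimes ca$, and $(A\widehat{\otimes}A)''$ is an $A$-bimodule canonically. $A$ is biflat if there is a bounded $A$-bimodule map $\sigma:A\to(A\widehat{\otimes}A)''$ with $\pi''\sigma=\kappa$. *)

(* Defs.v *)
From HB Require Import structures.
From mathcomp Require Import all_boot all_order all_algebra finmap.
From mathcomp Require Import complex.
From mathcomp Require Import mathcomp_extra boolp classical_sets functions
  cardinality fsbigop reals ereal topology normedtype esum exp.
From mathcomp Require Import lra.
From mathcomp Require summability.
Set Implicit Arguments.
Unset Strict Implicit.
Unset Printing Implicit Defensive.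
Import Order.TTheory GRing.Theory Num.Theory numFieldNormedType.Exports.
Local Open Scope classical_set_scope.
Local Open Scope ring_scope.
Local Open Scope complex_scope.

(* All Banach spaces are complex: the scalar field is R[i] for R : realType. *)
HB.instance Definition _ (R : realType) := NormedModule.copy R[i] (R[i])^o.
HB.instance Definition _ (R : realType) := Num.ClosedField.on R[i].

Section Nrm.
Context {R : realType}.

(* Norms on a normedModType R[i] are R[i]-valued; nrm is the same norm as an
   element of R, see nrmE. *)
Definition nrm {V : normedZmodType R[i]} (x : V) : R := complex.Re `|x|.

Lemma nrmE (V : normedZmodType R[i]) (x : V) : `|x| = (nrm x)%:C.
Proof. by rewrite /nrm RRe_real// ger0_real. Qed.

Lemma nrm_ge0 (V : normedZmodType R[i]) (x : V) : 0 <= nrm x.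
Proof. by rewrite -lecR -nrmE normr_ge0. Qed.

Lemma nrm0 (V : normedZmodType R[i]) : nrm (0 : V) = 0.
Proof. by rewrite /nrm normr0. Qed.

Lemma nrm0_eq0 (V : normedZmodType R[i]) (x : V) : nrm x = 0 -> x = 0.
Proof. by move=> x0; apply/normr0_eq0; rewrite nrmE x0. Qed.

Lemma nrmD (V : normedZmodType R[i]) (x y : V) : nrm (x + y) <= nrm x + nrm y.
Proof. by rewrite -lecR rmorphD /= -!nrmE ler_normD. Qed.

Lemma nrmN (V : normedZmodType R[i]) (x : V) : nrm (- x) = nrm x.
Proof. by rewrite /nrm normrN. Qed.

Lemma nrmBC (V : normedZmodType R[i]) (x y : V) : nrm (x - y) = nrm (y - x).
Proof. by rewrite /nrm distrC. Qed.

Lemma nrm_tri (V : normedZmodType R[i]) (y x z : V) :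
  nrm (x - z) <= nrm (x - y) + nrm (y - z).
Proof. by apply: le_trans (nrmD _ _); rewrite addrA subrK. Qed.

Lemma nrmZ (V : normedModType R[i]) (k : R[i]) (x : V) :
  nrm (k *: x) = nrm k * nrm x.
Proof. by apply: complexI; rewrite rmorphM /= -!nrmE normrZ. Qed.

Lemma nrmM (k l : R[i]) : nrm (k * l) = nrm k * nrm l.
Proof. exact: (nrmZ k l). Qed.

Lemma nrm1 : nrm (1 : R[i]) = 1.
Proof. by rewrite /nrm normr1. Qed.

Lemma le_nrm (V W : normedZmodType R[i]) (x : V) (y : W) (c : R) :
  (nrm x <= c * nrm y) = (`|x| <= c%:C * `|y|).
Proof. by rewrite !nrmE -rmorphM /= lecR. Qed.

Lemma nrm_sum (V : normedZmodType R[i]) I (s : seq I) (f : I -> V) :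
  nrm (\sum_(i <- s) f i) <= \sum_(i <- s) nrm (f i).
Proof.
elim: s => [|i s ih]; first by rewrite !big_nil nrm0.
by rewrite !big_cons (le_trans (nrmD _ _))// lerD2l.
Qed.

Lemma posC (e : R[i]) : 0 < e -> exists2 d : R, 0 < d & e = d%:C.
Proof.
move=> e0; exists (complex.Re e); last by rewrite RRe_real// gtr0_real.
by rewrite -ltcR RRe_real// gtr0_real.
Qed.

Lemma cvg_nrmP (V : normedModType R[i]) (F : set_system V) (FF : Filter F)
    (v : V) :
  F --> v <-> forall e : R, 0 < e -> \forall x \near F, nrm (v - x) <= e.
Proof.
split => [/cvgrPdist_le Fv e e0|Fv].
  have e0' : 0 < e%:C :> R[i] by rewrite ltcR.
  by apply: filterS (Fv _ e0') => x; rewrite nrmE lecR.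
apply/cvgrPdist_le => e /posC[d d0 ->].
by apply: filterS (Fv _ d0) => x; rewrite nrmE lecR.
Qed.

Lemma cauchy_nrm (V : normedModType R[i]) (F : set_system V)
    (FF : ProperFilter F) : cauchy F <->
  forall e : R, 0 < e -> exists v, \forall x \near F, nrm (v - x) <= e.
Proof.
split => [/cauchyP Fc e e0|Fc].
  have e0' : 0 < e%:C :> R[i] by rewrite ltcR.
  have [v Fv] := Fc _ e0'; exists v; apply: filterS Fv => x.
  by rewrite -ball_normE/= nrmE ltcR => /ltW.
apply/cauchyP => e /posC[d d0 ->].
have [|v Fv] := Fc (d / 2); first by rewrite divr_gt0.
exists v; apply: filterS Fv => x.
rewrite -ball_normE/= nrmE ltcR => /le_lt_trans; apply.
by rewrite ltr_pdivrMr// ltr_pMr// ltr1n.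
Qed.

Lemma nrm_Re (z : R[i]) : `|complex.Re z| <= nrm z.
Proof. by rewrite -lecR -nrmE normc_ge_Re. Qed.

Lemma nrm_Im (z : R[i]) : `|complex.Im z| <= nrm z.
Proof.
have := nrm_Re ('i%C * z : R[i]); rewrite (nrmM 'i%C z) mulrC ReiNIm normrN.
suff -> : nrm ('i%C : R[i]) = 1 by rewrite mul1r.
by rewrite /nrm normc_def/= expr0n/= add0r expr1n sqrtr1.
Qed.

Lemma nrm_ReIm (z : R[i]) : nrm z <= `|complex.Re z| + `|complex.Im z|.
Proof.
rewrite {1}(complexE z) (le_trans (@nrmD R[i] _ _))// lerD//.
  by rewrite /nrm normc_def/= expr0n/= addr0 sqrtr_sqr.
by rewrite /nrm normc_def/= !(mul0r,mul1r,mulr0) subr0 add0r expr0n/= add0r sqrtr_sqr.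
Qed.

Lemma cauchy_R (F : set_system R) (FF : ProperFilter F) :
  (forall e : R, 0 < e -> exists v, \forall x \near F, `|v - x| <= e) ->
  exists l, forall e : R, 0 < e -> \forall x \near F, `|l - x| <= e.
Proof.
move=> Fc.
have /R_complete/cvg_ex[l Fl] : cauchy F.
  apply/cauchyP => e e0.
  have [|v Fv] := Fc (e / 2); first by rewrite divr_gt0.
  exists v; apply: filterS Fv => x.
  rewrite -ball_normE/= => /le_lt_trans; apply.
  by rewrite ltr_pdivrMr// ltr_pMr// ltr1n.
by exists l => e e0; move/cvgrPdist_le : Fl; apply.
Qed.

Lemma Cx_complete (F : set_system R[i]) : ProperFilter F -> cauchy F -> cvg F.
Proof.
move=> FF /cauchy_nrm Fc.
have [|a Fa] := @cauchy_R (@complex.Re R @ F) (fmap_proper_filter _ FF).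
  move=> e /Fc[v Fv]; exists (complex.Re v); apply: filterS Fv => z /=.
  by apply: le_trans; rewrite -raddfB; exact: nrm_Re.
have [|b Fb] := @cauchy_R (@complex.Im R @ F) (fmap_proper_filter _ FF).
  move=> e /Fc[v Fv]; exists (complex.Im v); apply: filterS Fv => z /=.
  by apply: le_trans; rewrite -raddfB; exact: nrm_Im.
apply/cvg_ex; exists (a +i* b : R[i]); apply/(cvg_nrmP _) => e e0.
have e2 : 0 < e / 2 by rewrite divr_gt0.
have Fa2 : F [set z | `|a - complex.Re z| <= e / 2] := Fa _ e2.
have Fb2 : F [set z | `|b - complex.Im z| <= e / 2] := Fb _ e2.
apply: filterS (filterI Fa2 Fb2) => -[x y] /= [xa yb].
by rewrite (le_trans (nrm_ReIm _))//= (splitr e) lerD.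
Qed.

HB.instance Definition _ := Uniform_isComplete.Build R[i] Cx_complete.


Lemma filter_seq (T : Type) (S : eqType) (F : set_system T) (FF : Filter F)
    (P : S -> T -> Prop) (A : seq S) :
  (forall s, F (P s)) -> \forall v \near F, forall s, s \in A -> P s v.
Proof.
move=> FP; elim: A => [|s A ih]; first exact: nearW.
apply: filterS2 (FP s) ih => v Ps PA t; rewrite inE => /predU1P[->//|].
exact: PA.
Qed.

Lemma eval_complete (V : normedModType R[i]) (S : Type) (ev : V -> S -> R[i]) :
  (forall v w s, ev (v - w) s = ev v s - ev w s) ->
  (forall v s, nrm (ev v s) <= nrm v) ->
  (forall v w, (forall s, ev v s = ev w s) -> v = w) ->
  (forall (F : set_system V) (FF : ProperFilter F) (g : S -> R[i]),
    (forall s (e : R), 0 < e -> \forall v \near F, nrm (ev v s - g s) <= e) ->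
    forall v0 (e : R), (\forall v \near F, nrm (v0 - v) <= e) ->
    exists2 v, (forall s, ev v s = g s) & nrm (v0 - v) <= e) ->
  forall F : set_system V, ProperFilter F -> cauchy F -> cvg F.
Proof.
move=> evB evle evI Hcl F FF /cauchy_nrm Fc.
have /choice[g Fg] : forall s, exists z : R[i],
    forall e : R, 0 < e -> \forall v \near F, nrm (ev v s - z) <= e.
  move=> s.
  have /Cx_complete/cvg_ex[z Fz] : cauchy ((ev^~ s) @ F).
    apply/cauchy_nrm => e /Fc[v Fv]; exists (ev v s).
    apply: (@filterS _ F _ _ _ _ Fv) => w.
    by apply: le_trans; rewrite -evB.
  exists z => e e0; have /(cvg_nrmP _)/(_ _ e0) Fze := Fz.
  by apply: (@filterS _ F _ _ _ _ Fze) => v; rewrite nrmBC.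
have [v1 Fv1] := Fc _ ltr01.
have [v vg _] := Hcl F FF g Fg _ _ Fv1.
apply/cvg_ex; exists v; apply/(cvg_nrmP _) => e e0.
have [|v2 Fv2] := Fc (e / 2); first by rewrite divr_gt0.
have [w wg v2w] := Hcl F FF g Fg _ _ Fv2.
have -> : v = w by apply: evI => s; rewrite vg wg.
apply: filterS Fv2 => x v2x.
rewrite (le_trans (nrm_tri v2 _ _))// (splitr e) lerD//.
by rewrite nrmBC.
Qed.

End Nrm.

Section L1def.
Context {R : realType} {S : choiceType}.
Implicit Types f g : S -> R[i].

Definition l1norm f : \bar R := (\esum_(s in [set: S]) (nrm (f s))%:E)%E.

Definition l1pred : {pred S -> R[i]} := fun f => (l1norm f < +oo)%E.

Lemma l1norm_ge0 f : (0 <= l1norm f)%E.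
Proof. by apply: esum_ge0 => s _; rewrite lee_fin nrm_ge0. Qed.

Lemma l1norm_leP f (r : R) :
  (l1norm f <= r%:E)%E <-> forall A : {fset S}, \sum_(s <- A) nrm (f s) <= r.
Proof.
split => [fr A|Ar].
  rewrite -lee_fin; apply: le_trans fr; rewrite /l1norm.
  apply: esum_ge; exists [set` A]; first by split.
  by rewrite fsbig_finite//= set_fsetK sumEFin.
apply: ge_ereal_sup => _ [A [finA _] <-].
by rewrite fsbig_finite//= sumEFin lee_fin.
Qed.

Lemma l1predP f : reflect (exists r : R,
  forall A : {fset S}, \sum_(s <- A) nrm (f s) <= r) (f \in l1pred).
Proof.
apply: (iffP idP) => [|[r /l1norm_leP fr]]; last first.
  by rewrite unfold_in; apply: le_lt_trans fr _; rewrite ltry.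
rewrite unfold_in => fy; exists (fine (l1norm f)); apply/l1norm_leP.
by rewrite fineK// ge0_fin_numE// l1norm_ge0.
Qed.

Lemma l1pred_submod : submod_closed l1pred.
Proof.
split=> [|k f g /l1predP[r fr] /l1predP[q gq]].
  by apply/l1predP; exists 0 => A; rewrite big1// => s _; rewrite nrm0.
apply/l1predP; exists (nrm k * r + q) => A.
apply: le_trans (_ : \sum_(s <- A) (nrm k * nrm (f s) + nrm (g s)) <= _).
  by apply: ler_sum => s _; rewrite (le_trans (nrmD _ _))// nrmM.
by rewrite big_split/= -mulr_sumr lerD// ler_wpM2l// nrm_ge0.
Qed.

HB.instance Definition _ :=
  GRing.isSubmodClosed.Build R[i] (S -> R[i]) l1pred l1pred_submod.

End L1def.

Record l1 (R : realType) (S : choiceType) :=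
  L1 { l1fun :> S -> R[i] ; _ : l1fun \in l1pred }.

Section L1.
Context {R : realType} {S : choiceType}.
Local Notation l1 := (l1 R S).

HB.instance Definition _ := [isSub for @l1fun R S].
HB.instance Definition _ := [Choice of l1 by <:].
HB.instance Definition _ := [SubChoice_isSubLmodule of l1 by <:].

Implicit Types a b : l1.

Definition l1n a : R := fine (l1norm a).

Lemma l1nE a : (l1n a)%:E = l1norm a.
Proof.
have := valP a; rewrite unfold_in => ay.
by rewrite fineK// ge0_fin_numE// l1norm_ge0.
Qed.

Lemma l1n_leP a (r : R) :
  l1n a <= r <-> forall A : {fset S}, \sum_(s <- A) nrm (a s) <= r.
Proof. by rewrite -lee_fin l1nE; exact: l1norm_leP. Qed.

Lemma l1n_sum a (A : {fset S}) : \sum_(s <- A) nrm (a s) <= l1n a.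
Proof. by move: A; apply/l1n_leP. Qed.

Lemma l1n_ge0 a : 0 <= l1n a.
Proof. by rewrite -lee_fin l1nE l1norm_ge0. Qed.

Lemma l1P a b : (forall s, a s = b s) -> a = b.
Proof. by move=> ab; apply/val_inj/funext. Qed.

Lemma l1DE a b s : (a + b) s = a s + b s. Proof. by []. Qed.
Lemma l1NE a s : (- a) s = - a s. Proof. by []. Qed.
Lemma l1ZE k a s : (k *: a) s = k * a s. Proof. by []. Qed.
Lemma l10E s : (0 : l1) s = 0. Proof. by []. Qed.

Lemma l1n_eval a s : nrm (a s) <= l1n a.
Proof. by have := l1n_sum a [fset s]%fset; rewrite big_seq_fset1. Qed.

Let norm a : R[i] := (l1n a)%:C.

Let normD a b : norm (a + b) <= norm a + norm b.
Proof.
rewrite -rmorphD lecR; apply/l1n_leP => A.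
apply: le_trans (_ : \sum_(s <- A) (nrm (a s) + nrm (b s)) <= _).
  by apply: ler_sum => s _; rewrite nrmD.
by rewrite big_split/= lerD// l1n_sum.
Qed.

Let normZ_le (k : R[i]) a : l1n (k *: a) <= nrm k * l1n a.
Proof.
apply/l1n_leP => A.
rewrite (eq_bigr (fun s => nrm k * nrm (a s)))// => [|s _]; last by rewrite -nrmM.
by rewrite -mulr_sumr ler_wpM2l ?nrm_ge0// l1n_sum.
Qed.

Let normZ (k : R[i]) a : norm (k *: a) = `|k| * norm a.
Proof.
rewrite nrmE -rmorphM; congr (_%:C); apply/eqP; rewrite eq_le normZ_le/=.
have [->|k0] := eqVneq k 0; first by rewrite nrm0 mul0r l1n_ge0.
have k0' : 0 < nrm k.
  by rewrite lt_neqAle nrm_ge0 andbT eq_sym; apply: contra_neq k0 => /nrm0_eq0.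
rewrite mulrC -ler_pdivlMr// -[X in l1n X <= _](scalerK k0 a).
rewrite (le_trans (normZ_le _ _))// mulrC ler_wpM2l ?l1n_ge0//.
rewrite -[leRHS]mul1r -ler_pdivrMr ?invr_gt0// invrK -nrmM.
by rewrite mulVf// nrm1.
Qed.

Let norm0 a : norm a = 0 -> a = 0.
Proof.
move/complexI => a0; apply: l1P => s; apply/nrm0_eq0/eqP.
by rewrite eq_le nrm_ge0 andbT -a0 l1n_eval.
Qed.

HB.instance Definition _ := Lmodule_isNormed.Build R[i] l1 normD normZ norm0.

Lemma l1_nrmE a : nrm a = l1n a. Proof. by []. Qed.

Lemma l1_nrmEe a : (nrm a)%:E = l1norm a. Proof. exact: l1nE. Qed.

Lemma l1_complete (F : set_system l1) : ProperFilter F -> cauchy F -> cvg F.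
Proof.
apply: (@eval_complete _ _ S (fun a => a : S -> R[i])) => //.
- by move=> a s; exact: l1n_eval.
- exact: l1P.
move=> {}F FF g Fg v0 e Fv0.
have key (A : {fset S}) : \sum_(s <- A) nrm (v0 s - g s) <= e.
  apply/ler_addgt0Pr => d d0.
  pose N := (size A).+1%:R : R.
  have N0 : 0 < N by rewrite ltr0n.
  have dN : 0 < d / N by rewrite divr_gt0.
  have FA : F [set v : l1 | forall s, s \in enum_fset A -> nrm (v s - g s) <= d / N].
    by apply: filter_seq => s; exact: Fg.
  have [v [/= v0v vg]] := @filter_ex _ F FF _ (filterI Fv0 FA).
  apply: le_trans (_ : \sum_(s <- A) (nrm (v0 s - v s) + d / N) <= _).
    rewrite big_seq [leRHS]big_seq; apply: ler_sum => s sA.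
    by rewrite (le_trans (nrm_tri (v s) _ _))// lerD// vg.
  rewrite big_split/= lerD//; first exact: le_trans (l1n_sum (v0 - v) A) v0v.
  rewrite big_const_seq count_predT iter_addr_0 -mulr_natr -mulrA ger_pMr// mulrC.
  by rewrite ler_pdivrMr// mul1r ler_nat.
have gl1 : g \in l1pred.
  have h : (fun s => v0 s - g s) \in l1pred by apply/l1predP; exists e.
  have -> : g = (v0 : S -> R[i]) - (fun s => v0 s - g s).
    by apply/funext => s; rewrite /= fctE/= opprB addrC subrK.
  by rewrite rpredB// (valP v0).
by exists (L1 gl1) => //; rewrite l1_nrmE; apply/l1n_leP.
Qed.

HB.instance Definition _ := Uniform_isComplete.Build l1 l1_complete.

End L1.

Section Linfdef.
Context {R : realType} {S : Type}.
Implicit Types f g : S -> R[i].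

Definition linfpred : {pred S -> R[i]} :=
  fun f => `[< exists M : R, forall s, nrm (f s) <= M >].

Lemma linfpred_submod : submod_closed linfpred.
Proof.
split=> [|k f g /asboolP[r fr] /asboolP[q gq]].
  by apply/asboolP; exists 0 => s; rewrite nrm0.
apply/asboolP; exists (nrm k * r + q) => s.
by rewrite (le_trans (nrmD _ _))// nrmM lerD// ler_wpM2l// nrm_ge0.
Qed.

HB.instance Definition _ :=
  GRing.isSubmodClosed.Build R[i] (S -> R[i]) linfpred linfpred_submod.

End Linfdef.

Record linf (R : realType) (S : Type) :=
  Linf { linffun :> S -> R[i] ; _ : linffun \in linfpred }.

Section Linf.
Context {R : realType} {S : Type}.
Local Notation linf := (linf R S).

HB.instance Definition _ := [isSub for @linffun R S].
HB.instance Definition _ := [Choice of linf by <:].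
HB.instance Definition _ := [SubChoice_isSubLmodule of linf by <:].

Implicit Types a b : linf.

(* sup set0 = 0, so this is also correct when S is empty *)
Definition linfn a : R := sup [set nrm (a s) | s in [set: S]].

Lemma linfn_eval a s : nrm (a s) <= linfn a.
Proof.
apply: ub_le_sup; last by exists s.
have /asboolP[M aM] := valP a; exists M => _ [t _ <-]; exact: aM.
Qed.

Lemma linfn_leP a (r : R) : 0 <= r ->
  linfn a <= r <-> forall s, nrm (a s) <= r.
Proof.
move=> r0; split => [ar s|ar]; first exact: le_trans (linfn_eval _ _) ar.
have [[s0]|S0] := pselect (inhabited S).
  by apply: ge_sup => [|_ [s _ <-]//]; exists (nrm (a s0)), s0.
rewrite /linfn (_ : [set _ | _ in _] = set0) ?sup0//.
by rewrite -subset0 => x [s _ _]; case: S0; exists.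
Qed.

Lemma linfn_ge0 a : 0 <= linfn a.
Proof.
have [[s]|S0] := pselect (inhabited S).
  by apply: le_trans (linfn_eval a s); rewrite nrm_ge0.
rewrite /linfn (_ : [set _ | _ in _] = set0) ?sup0//.
by rewrite -subset0 => x [s _ _]; case: S0; exists.
Qed.

Lemma linfP a b : (forall s, a s = b s) -> a = b.
Proof. by move=> ab; apply/val_inj/funext. Qed.

Let norm a : R[i] := (linfn a)%:C.

Let normD a b : norm (a + b) <= norm a + norm b.
Proof.
rewrite -rmorphD lecR; apply/linfn_leP => [|s]; first by rewrite addr_ge0 ?linfn_ge0.
by rewrite (le_trans (nrmD _ _))// lerD// linfn_eval.
Qed.

Let normZ_le (k : R[i]) a : linfn (k *: a) <= nrm k * linfn a.
Proof.
apply/linfn_leP => [|s]; first by rewrite mulr_ge0 ?linfn_ge0 ?nrm_ge0.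
by rewrite nrmM ler_wpM2l ?nrm_ge0// linfn_eval.
Qed.

Let normZ (k : R[i]) a : norm (k *: a) = `|k| * norm a.
Proof.
rewrite nrmE -rmorphM; congr (_%:C); apply/eqP; rewrite eq_le normZ_le/=.
have [->|k0] := eqVneq k 0; first by rewrite nrm0 mul0r linfn_ge0.
have k0' : 0 < nrm k.
  by rewrite lt_neqAle nrm_ge0 andbT eq_sym; apply: contra_neq k0 => /nrm0_eq0.
rewrite mulrC -ler_pdivlMr// -[X in linfn X <= _](scalerK k0 a).
rewrite (le_trans (normZ_le _ _))// mulrC ler_wpM2l ?linfn_ge0//.
rewrite -[leRHS]mul1r -ler_pdivrMr ?invr_gt0// invrK -nrmM.
by rewrite mulVf// nrm1.
Qed.

Let norm0 a : norm a = 0 -> a = 0.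
Proof.
move/complexI => a0; apply: linfP => s; apply/nrm0_eq0/eqP.
by rewrite eq_le nrm_ge0 andbT -a0 linfn_eval.
Qed.

HB.instance Definition _ := Lmodule_isNormed.Build R[i] linf normD normZ norm0.

Lemma linf_nrmE a : nrm a = linfn a. Proof. by []. Qed.

Lemma linf_complete (F : set_system linf) : ProperFilter F -> cauchy F -> cvg F.
Proof.
apply: (@eval_complete _ _ S (fun a => a : S -> R[i])) => //.
- by move=> a s; exact: linfn_eval.
- exact: linfP.
move=> {}F FF g Fg v0 e Fv0.
have key s : nrm (v0 s - g s) <= e.
  apply/ler_addgt0Pr => d d0.
  have [v [/= v0v vg]] := @filter_ex _ F FF _ (filterI Fv0 (Fg s d d0)).
  rewrite (le_trans (nrm_tri (v s) _ _))// lerD//.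
  exact: le_trans (linfn_eval (v0 - v) s) v0v.
have glinf : g \in linfpred.
  have h : (fun s => v0 s - g s) \in linfpred by apply/asboolP; exists e.
  have -> : g = (v0 : S -> R[i]) - (fun s => v0 s - g s).
    by apply/funext => s; rewrite /= fctE/= opprB addrC subrK.
  by rewrite rpredB// (valP v0).
exists (Linf glinf) => //; rewrite linf_nrmE; apply/linfn_leP => //.
have [v /= v0v] := @filter_ex _ F FF _ Fv0.
exact: le_trans (nrm_ge0 _) v0v.
Qed.

HB.instance Definition _ := Uniform_isComplete.Build linf linf_complete.

End Linf.

Section BLdef.
Context {R : realType} {V W : normedModType R[i]}.

Definition blpred : {pred V -> W} := fun f =>
  `[< linear f /\ exists M : R, forall x, nrm (f x) <= M * nrm x >].

Lemma blpred_submod : submod_closed blpred.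
Proof.
split=> [|k f g /asboolP[fl [r fr]] /asboolP[gl [q gq]]]; apply/asboolP; split.
- by move=> k x y; rewrite -[LHS]/(0 : W) -[RHS]/(k *: (0 : W) + 0) scaler0 addr0.
- by exists 0 => x; rewrite nrm0 mul0r.
- move=> c x y; rewrite -[LHS]/(k *: f (c *: x + y) + g (c *: x + y)) fl gl.
  rewrite -[RHS]/(c *: (k *: f x + g x) + (k *: f y + g y)).
  by rewrite !scalerDr !scalerA mulrC addrACA.
- exists (nrm k * r + q) => x.
  rewrite (le_trans (nrmD _ _))// nrmZ mulrDl -mulrA lerD//.
  by rewrite ler_wpM2l// nrm_ge0.
Qed.

HB.instance Definition _ :=
  GRing.isSubmodClosed.Build R[i] (V -> W) blpred blpred_submod.

End BLdef.

Record blmap (R : realType) (V W : normedModType R[i]) :=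
  BL { blfun :> V -> W ; _ : blfun \in blpred }.

Section BL.
Context {R : realType} {V W : normedModType R[i]}.
Local Notation blmap := (blmap V W).

HB.instance Definition _ := [isSub for @blfun R V W].
HB.instance Definition _ := [Choice of blmap by <:].
HB.instance Definition _ := [SubChoice_isSubLmodule of blmap by <:].

Implicit Types f g : blmap.

Lemma blfun_linear f : linear f.
Proof. by have /asboolP[] := valP f. Qed.

HB.instance Definition _ f :=
  GRing.isLinear.Build R[i] V W *:%R (blfun f) (blfun_linear f).

Lemma blP f g : (forall x, f x = g x) -> f = g.
Proof. by move=> fg; apply/val_inj/funext. Qed.

Definition opnorm f : R := sup [set nrm (f x) | x in [set x : V | nrm x <= 1]].

Let nonempty f : [set nrm (f x) | x in [set x : V | nrm x <= 1]] !=set0.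
Proof. by exists (nrm (f 0)), 0 => //=; rewrite nrm0. Qed.

Lemma opnorm_ge f x : nrm x <= 1 -> nrm (f x) <= opnorm f.
Proof.
move=> x1; apply: ub_le_sup; last by exists x.
have /asboolP[_ [M fM]] := valP f; exists `|M| => _ [y /= y1 <-].
rewrite (le_trans (fM y))// (le_trans (ler_norm _))// normrM.
by rewrite ler_piMr// ger0_norm// nrm_ge0.
Qed.

Lemma opnorm_ge0 f : 0 <= opnorm f.
Proof. by rewrite (le_trans (nrm_ge0 (f 0)))// opnorm_ge// nrm0. Qed.

Lemma opnorm_eval f x : nrm (f x) <= opnorm f * nrm x.
Proof.
have [->|x0] := eqVneq x 0; first by rewrite linear0 !nrm0 mulr0.
have x0' : 0 < nrm x.
  by rewrite lt_neqAle nrm_ge0 andbT eq_sym; apply: contra_neq x0 => /nrm0_eq0.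
rewrite -ler_pdivrMr//.
have -> : nrm (f x) / nrm x = nrm (f ((nrm x)^-1%:C *: x)).
  rewrite linearZ nrmZ mulrC; congr (_ * _).
  by rewrite /nrm normc_def/= expr0n/= addr0 sqrtr_sqr ger0_norm// invr_ge0 ltW.
apply: opnorm_ge; rewrite nrmZ.
rewrite [X in X * _]/nrm normc_def/= expr0n/= addr0 sqrtr_sqr ger0_norm ?invr_ge0 ?(ltW x0')//.
by rewrite mulVf// gt_eqF.
Qed.

Lemma opnorm_leP f (r : R) : 0 <= r ->
  opnorm f <= r <-> forall x, nrm (f x) <= r * nrm x.
Proof.
move=> r0; split=> [fr x|fr].
  by rewrite (le_trans (opnorm_eval f x))// ler_wpM2r// nrm_ge0.
apply: ge_sup => // _ [x /= x1 <-].
by rewrite (le_trans (fr x))// ler_piMr.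
Qed.

Let norm f : R[i] := (opnorm f)%:C.

Let normD f g : norm (f + g) <= norm f + norm g.
Proof.
rewrite -rmorphD lecR; apply/opnorm_leP => [|x].
  by rewrite addr_ge0 ?opnorm_ge0.
by rewrite (le_trans (nrmD _ _))// mulrDl lerD// opnorm_eval.
Qed.

Let normZ_le (k : R[i]) f : opnorm (k *: f) <= nrm k * opnorm f.
Proof.
apply/opnorm_leP => [|x]; first by rewrite mulr_ge0 ?opnorm_ge0 ?nrm_ge0.
by rewrite nrmZ -mulrA ler_wpM2l ?nrm_ge0// opnorm_eval.
Qed.

Let normZ (k : R[i]) f : norm (k *: f) = `|k| * norm f.
Proof.
rewrite nrmE -rmorphM; congr (_%:C); apply/eqP; rewrite eq_le normZ_le/=.
have [->|k0] := eqVneq k 0; first by rewrite nrm0 mul0r opnorm_ge0.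
have k0' : 0 < nrm k.
  by rewrite lt_neqAle nrm_ge0 andbT eq_sym; apply: contra_neq k0 => /nrm0_eq0.
rewrite mulrC -ler_pdivlMr// -[X in opnorm X <= _](scalerK k0 f).
rewrite (le_trans (normZ_le _ _))// mulrC ler_wpM2l ?opnorm_ge0//.
rewrite -[leRHS]mul1r -ler_pdivrMr ?invr_gt0// invrK -nrmM.
by rewrite mulVf// nrm1.
Qed.

Let norm0 f : norm f = 0 -> f = 0.
Proof.
move/complexI => f0; apply: blP => x; apply/nrm0_eq0/eqP.
by rewrite eq_le nrm_ge0 andbT (le_trans (opnorm_eval f x))// f0 mul0r.
Qed.

HB.instance Definition _ := Lmodule_isNormed.Build R[i] blmap normD normZ norm0.

Lemma bl_nrmE f : nrm f = opnorm f. Proof. by []. Qed.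

Lemma bl_eval f x : nrm (f x) <= nrm f * nrm x.
Proof. exact: opnorm_eval. Qed.

Lemma bl_leP f (r : R) : 0 <= r ->
  nrm f <= r <-> forall x, nrm (f x) <= r * nrm x.
Proof. exact: opnorm_leP. Qed.

Lemma blpredI (f : V -> W) (M : R) :
  linear f -> (forall x, nrm (f x) <= M * nrm x) -> f \in blpred.
Proof. by move=> fl fM; apply/asboolP; split=> //; exists M. Qed.

End BL.

Section Dual.
Context {R : realType}.
Implicit Types V W U : normedModType R[i].

Definition dual V : normedModType R[i] := blmap V R[i].

Lemma comp_bl V W U (g : blmap W U) (f : blmap V W) : g \o f \in blpred.
Proof.
apply: (@blpredI _ _ _ _ (nrm g * nrm f)) => [k x y /=|x /=].
  by rewrite !linearP.
by rewrite (le_trans (bl_eval _ _))// -mulrA ler_wpM2l ?nrm_ge0// bl_eval.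
Qed.

Definition blcomp V W U (g : blmap W U) (f : blmap V W) : blmap V U :=
  BL (comp_bl g f).

Lemma adjoint_bl V W (f : blmap V W) :
  (fun u : dual W => blcomp u f : dual V) \in blpred.
Proof.
apply: (@blpredI _ _ _ _ (nrm f)) => [k u v|u]; first exact: blP.
apply/bl_leP => [|x /=]; first by rewrite mulr_ge0 ?nrm_ge0.
by rewrite (le_trans (bl_eval _ _))// [nrm f * _]mulrC -mulrA ler_wpM2l ?nrm_ge0// bl_eval.
Qed.

Definition adjoint V W (f : blmap V W) : blmap (dual W) (dual V) :=
  BL (adjoint_bl f).

Lemma eval_bl V (x : V) : (fun u : dual V => u x) \in blpred.
Proof.
apply: (@blpredI _ _ _ _ (nrm x)) => // u.
by rewrite (le_trans (bl_eval u x))// mulrC.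
Qed.

Lemma kappa_bl V : (fun x : V => BL (eval_bl x) : dual (dual V)) \in blpred.
Proof.
apply: (@blpredI _ _ _ _ 1) => [k x y|x]; first by apply: blP => u /=; rewrite linearP.
rewrite mul1r; apply/bl_leP => [|u /=]; first exact: nrm_ge0.
by rewrite (le_trans (bl_eval u x))// mulrC.
Qed.

Definition kappa V : blmap V (dual (dual V)) := BL (kappa_bl V).

End Dual.

Section Lift.
Context {R : realType} {S : choiceType}.
Local Notation l1 := (l1 R S).

Lemma delta_l1 (t : S) : (fun s => (s == t)%:R : R[i]) \in l1pred.
Proof.
apply/l1predP; exists 1 => A.
have [tA|tA] := boolP (t \in A).
  rewrite (big_rem t)//= eqxx nrm1 big_seq big1 ?addr0// => s.
  rewrite mem_rem_uniq ?fset_uniq// inE => /andP[/negbTE -> _].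
  exact: nrm0.
rewrite big_seq big1// => s sA; rewrite (_ : s == t = false) ?nrm0//.
by apply: contraNF tA => /eqP <-.
Qed.

Definition delta (t : S) : l1 := L1 (delta_l1 t).

Lemma fsub_sum (W : zmodType) (f : S -> W) (A B : {fset S}) :
  (A `<=` B)%fset ->
  \sum_(s <- B) f s = \sum_(s <- A) f s + \sum_(s <- (B `\` A)%fset) f s.
Proof.
move=> AB; rewrite -big_cat/=; apply: perm_big; apply: uniq_perm.
- exact: fset_uniq.
- rewrite cat_uniq !fset_uniq/= andbT -all_predC; apply/allP => s /=.
  by rewrite in_fsetD => /andP[].
- move=> s; rewrite mem_cat in_fsetD.
  by case: (boolP (s \in A)) => //= sA; rewrite (fsubsetP AB).
Qed.

Lemma fsum_le (f : S -> R) (A B : {fset S}) : (forall s, 0 <= f s) ->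
  (A `<=` B)%fset -> \sum_(s <- A) f s <= \sum_(s <- B) f s.
Proof.
by move=> f0 AB; rewrite (fsub_sum _ AB) lerDl sumr_ge0.
Qed.

Lemma l1_tail (a : l1) (e : R) : 0 < e -> exists A : {fset S},
  forall B : {fset S}, [disjoint A & B]%fset -> \sum_(s <- B) nrm (a s) <= e.
Proof.
move=> e0.
have [A Ae] : exists A : {fset S}, nrm a - e < \sum_(s <- A) nrm (a s).
  apply: contrapT => /forallNP H.
  have : nrm a <= nrm a - e.
    by apply/l1n_leP => A; rewrite leNgt; apply/negP/H.
  by move=> ?; lra.
exists A => B AB; have := l1n_sum a (A `|` B)%fset.
rewrite (fsub_sum _ (fsubsetUl A B)) fsetDUl fsetDv fset0U.
have -> : (B `\` A = B)%fset by apply/fsetDidPl; rewrite fdisjoint_sym.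
by rewrite -l1_nrmE => ?; lra.
Qed.

Lemma delta_expansion (a : l1) (e : R) : 0 < e -> exists A : {fset S},
  forall B : {fset S}, (A `<=` B)%fset ->
    nrm (a - \sum_(s <- B) a s *: delta s) <= e.
Proof.
move=> /(l1_tail a)[A Ae]; exists A => B AB.
apply/l1n_leP => D.
have fE t : (a - \sum_(s <- B) a s *: delta s) t = if t \in B then 0 else a t.
  rewrite l1DE l1NE.
  have -> : (\sum_(s <- B) a s *: delta s) t = \sum_(s <- B) a s * (t == s)%:R.
    by elim/big_ind2 : _ => // x y z w <- <-.
  have [tB|tB] := boolP (t \in B).
    rewrite (big_rem t)//= eqxx mulr1 big_seq big1 ?addr0 ?subrr// => s.
    by rewrite mem_rem_uniq ?fset_uniq// inE eq_sym => /andP[/negbTE -> _]; rewrite mulr0.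
  rewrite big_seq big1 ?subr0// => s sB; rewrite (_ : t == s = false) ?mulr0//.
  by apply: contraNF tB => /eqP ->.
apply: le_trans (Ae (D `\` B)%fset _); last first.
  by apply/fdisjointP => s sA; rewrite in_fsetD (fsubsetP AB).
rewrite (eq_bigr _ (fun t _ => congr1 nrm (fE t))).
rewrite (big_fsetID _ (mem B))/= [X in X + _]big_seq big1 ?add0r => [|t]; last first.
  by rewrite !inE/= => /andP[_ ->]; rewrite nrm0.
apply: (@le_trans _ _ (\sum_(s <- (D `\` B)%fset) nrm (if s \in B then 0 else a s))).
  by apply: fsum_le => [s|]; [exact: nrm_ge0|apply/fsubsetP => s; rewrite !inE/= andbC].
by rewrite big_seq [leRHS]big_seq; apply: ler_sum => s; rewrite inE => /andP[/negbTE ->].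
Qed.

Lemma l1_ext (W : normedModType R[i]) (f g : blmap l1 W) :
  (forall s, f (delta s) = g (delta s)) -> f = g.
Proof.
move=> fg; apply/eqP; rewrite -subr_eq0; apply/eqP; set h := f - g.
have h0 s : h (delta s) = 0 by rewrite -[LHS]/(f _ - g _) fg subrr.
apply: blP => a; apply/nrm0_eq0/eqP; rewrite eq_le nrm_ge0 andbT.
apply/ler_addgt0Pr => e e0; rewrite add0r.
have h1 : 0 < nrm h + 1 by rewrite ltr_wpDl// nrm_ge0.
have [|A /(_ A (fsubset_refl _)) Ae] := @delta_expansion a (e / (nrm h + 1)).
  by rewrite divr_gt0.
have -> : h a = h (a - \sum_(s <- A) a s *: delta s).
  rewrite linearB linear_sum big1 ?subr0// => s _.
  by transitivity (a s *: h (delta s)); [exact: linearZ|rewrite h0 scaler0].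
rewrite (le_trans (bl_eval _ _))//.
apply: (@le_trans _ _ ((nrm h + 1) * (e / (nrm h + 1)))).
  by apply: ler_pM; rewrite ?nrm_ge0 ?lerDl.
by rewrite mulrC divfK// gt_eqF.
Qed.

Section lift.
Context {W : completeNormedModType R[i]}.
Variables (Phi : S -> W) (M : R).
Hypothesis PhiM : forall s, nrm (Phi s) <= M.

(* The unconditional sum of the a s *: Phi s, i.e. the bounded linear extension
   of delta s |-> Phi s for bounded Phi, see lift_bl, lift_delta and l1_ext. *)
Definition lift (Phi : S -> W) (a : l1) : W :=
  summability.sum (fun s => a s *: Phi s).

Lemma partial_sumE (x : S -> W) (A : {fset S}) :
  summability.partial_sum x A = \sum_(s <- A) x s.
Proof. by rewrite /summability.partial_sum -(big_seq_fsetE _ _ predT). Qed.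

Let M0 (a : l1) : a != 0 -> 0 <= M.
Proof.
move=> a0; have [s as0] : exists s, a s != 0.
  apply: contrapT => /forallNP H; case/eqP: a0; apply: l1P => s.
  by apply/eqP/negPn/negP/H.
exact: le_trans (nrm_ge0 _) (PhiM s).
Qed.

Lemma lift_tail (a : l1) (e : R) : 0 < e -> exists A : {fset S},
  forall B : {fset S}, (A `<=` B)%fset ->
    nrm (\sum_(s <- A) a s *: Phi s - \sum_(s <- B) a s *: Phi s) <= e.
Proof.
move=> e0; have M1 : 0 < `|M| + 1 by rewrite ltr_wpDl.
have [|A Ae] := @l1_tail a (e / (`|M| + 1)); first by rewrite divr_gt0.
exists A => B AB; rewrite nrmBC (fsub_sum _ AB) addrC addKr.
rewrite (le_trans (nrm_sum _ _))//.
apply: le_trans (_ : (`|M| + 1) * \sum_(s <- (B `\` A)%fset) nrm (a s) <= _).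
  rewrite mulr_sumr; apply: ler_sum => s _; rewrite nrmZ mulrC.
  rewrite ler_wpM2r ?nrm_ge0// (le_trans (PhiM s))// (le_trans (ler_norm M))//.
  by rewrite lerDl.
rewrite -ler_pdivlMl// mulrC Ae//.
by apply/fdisjointP => s sA; rewrite in_fsetD sA.
Qed.

Lemma lift_cvg (a : l1) (e : R) : 0 < e -> exists A : {fset S},
  forall B : {fset S}, (A `<=` B)%fset ->
    nrm (lift Phi a - \sum_(s <- B) a s *: Phi s) <= e.
Proof.
move=> e0; have : cvg (summability.partial_sum (fun s => a s *: Phi s) @ summability.totally).
  have FF := @fmap_proper_filter _ _
    (summability.partial_sum (fun s => a s *: Phi s)) _ summability.totally_filter.
  apply: cauchy_cvg; apply/cauchy_nrm => d /(lift_tail a)[A Ad].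
  exists (\sum_(s <- A) a s *: Phi s); exists A => //= B AB.
  by rewrite /= partial_sumE Ad.
have FF := @fmap_filter _ _
  (summability.partial_sum (fun s => a s *: Phi s)) _
  (@filter_filter _ _ summability.totally_filter).
move=> /(cvg_nrmP FF)/(_ _ e0)[A _ Ae]; exists A => B AB.
by have := Ae B AB; rewrite /= partial_sumE.
Qed.

Lemma lift_nrm (a : l1) : nrm (lift Phi a) <= M * nrm a.
Proof.
have [->|a0] := eqVneq a 0.
  rewrite nrm0 mulr0; apply/ler_addgt0Pr => e /(lift_cvg 0)[A].
  move=> /(_ A (fsubset_refl _)); rewrite big1 ?subr0 ?add0r// => s _.
  by rewrite l10E scale0r.
apply/ler_addgt0Pr => e /(lift_cvg a)[A /(_ A (fsubset_refl _)) Ae].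
set x := \sum_(s <- A) _ in Ae.
have -> : lift Phi a = x + (lift Phi a - x) by rewrite addrC subrK.
rewrite (le_trans (nrmD _ _))// lerD//.
rewrite (le_trans (nrm_sum _ _))//.
apply: le_trans (_ : M * \sum_(s <- A) nrm (a s) <= _).
  rewrite mulr_sumr; apply: ler_sum => s _; rewrite nrmZ mulrC.
  by rewrite ler_wpM2r ?nrm_ge0.
by rewrite ler_wpM2l ?(M0 a0)// l1n_sum.
Qed.

Lemma lift_linear : linear (lift Phi).
Proof.
move=> k a b; apply/eqP; rewrite -subr_eq0; apply/eqP/nrm0_eq0/eqP.
rewrite eq_le nrm_ge0 andbT; apply/ler_addgt0Pr => e e0; rewrite add0r.
pose d := e / (nrm k + 2).
have k2 : 0 < nrm k + 2 by rewrite ltr_wpDl ?nrm_ge0.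
have d0 : 0 < d by rewrite divr_gt0.
have [A Ad] := lift_cvg (k *: a + b) d0.
have [B Bd] := lift_cvg a d0.
have [D Dd] := lift_cvg b d0.
pose X := (A `|` B `|` D)%fset.
have {}Ad := Ad X (fsubset_trans (fsubsetUl _ _) (fsubsetUl _ _)).
have {}Bd := Bd X (fsubset_trans (fsubsetUr _ _) (fsubsetUl _ _)).
have {}Dd := Dd X (fsubsetUr _ _).
set u := lift Phi _ in Ad *; set v := lift Phi _ in Bd *; set w := lift Phi _ in Dd *.
have XE : \sum_(s <- X) (k *: a + b) s *: Phi s =
    k *: (\sum_(s <- X) a s *: Phi s) + \sum_(s <- X) b s *: Phi s.
  rewrite scaler_sumr -big_split/=; apply: eq_bigr => s _.
  by transitivity ((k * a s + b s) *: Phi s); rewrite // scalerDl scalerA.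
set x := \sum_(s <- X) (k *: a + b) s *: Phi s in Ad XE.
set y := \sum_(s <- X) a s *: Phi s in Bd XE.
set z := \sum_(s <- X) b s *: Phi s in Dd XE.
have -> : u - (k *: v + w) = (u - x) - (k *: (v - y) + (w - z)).
  by rewrite scalerBr addrACA -opprD -XE opprB addrA subrK.
rewrite (le_trans (nrmD _ _))// nrmN.
have : nrm (k *: (v - y) + (w - z)) <= nrm k * d + d.
  by rewrite (le_trans (nrmD _ _))// lerD// nrmZ ler_wpM2l ?nrm_ge0.
move=> h; apply: le_trans (lerD Ad h) _.
have -> : e = d * (nrm k + 2) by rewrite /d divfK// gt_eqF.
lra.
Qed.

Lemma lift_bl : lift Phi \in blpred.
Proof. exact: blpredI lift_linear lift_nrm. Qed.

Definition liftbl : blmap l1 W := BL lift_bl.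

Lemma lift_delta s : lift Phi (delta s) = Phi s.
Proof.
apply/eqP; rewrite -subr_eq0; apply/eqP/nrm0_eq0/eqP.
rewrite eq_le nrm_ge0 andbT; apply/ler_addgt0Pr => e /(lift_cvg (delta s))[A].
move=> /(_ _ (fsubsetUr [fset s]%fset A)); rewrite add0r.
rewrite (big_rem s) ?inE ?eqxx//= eqxx scale1r big_seq big1 ?addr0// => t.
by rewrite mem_rem_uniq ?fset_uniq// inE => /andP[/negbTE -> _]; rewrite scale0r.
Qed.

End lift.
End Lift.

(* Not necessarily unital *)
HB.mixin Record isBanachAlgebra (K : numFieldType) A
    & CompleteNormedModule K A := {
  bmul : A -> A -> A;
  bmulA : associative bmul;
  bmulPl : forall (k : K) (a a' b : A),
    bmul (k *: a + a') b = k *: bmul a b + bmul a' b;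
  bmulPr : forall (k : K) (a b b' : A),
    bmul a (k *: b + b') = k *: bmul a b + bmul a b';
  bnormM : forall a b : A, `|bmul a b| <= `|a| * `|b|
}.

#[short(type="banachAlgType")]
HB.structure Definition BanachAlgebra (K : numFieldType) :=
  {A of isBanachAlgebra K A & CompleteNormedModule K A}.

Notation "a ** b" := (bmul a b) (at level 40, left associativity) : ring_scope.

Section Pointwise.
Context {R : realType} {S : choiceType}.
Implicit Types a b : l1 R S.

Lemma pmul_sum a b (A : {fset S}) :
  \sum_(s <- A) nrm (a s * b s) <= nrm a * nrm b.
Proof.
apply: le_trans (_ : nrm a * \sum_(s <- A) nrm (b s) <= _).
  rewrite mulr_sumr; apply: ler_sum => s _; rewrite nrmM.
  by rewrite ler_wpM2r ?nrm_ge0// l1n_eval.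
by rewrite ler_wpM2l ?nrm_ge0// l1n_sum.
Qed.

Lemma pmul_l1 a b : (fun s => a s * b s) \in l1pred.
Proof. by apply/l1predP; exists (nrm a * nrm b); exact: pmul_sum. Qed.

Definition pmul a b : l1 R S := L1 (pmul_l1 a b).

Lemma pmulA : associative pmul.
Proof. by move=> a b c; apply: l1P => s /=; rewrite mulrA. Qed.

Lemma pmulPl (k : R[i]) a a' b : pmul (k *: a + a') b = k *: pmul a b + pmul a' b.
Proof.
apply: l1P => s; rewrite -[LHS]/((k * a s + a' s) * b s).
by rewrite -[RHS]/(k * (a s * b s) + a' s * b s) mulrDl mulrA.
Qed.

Lemma pmulPr (k : R[i]) a b b' : pmul a (k *: b + b') = k *: pmul a b + pmul a b'.
Proof.
apply: l1P => s; rewrite -[LHS]/(a s * (k * b s + b' s)).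
by rewrite -[RHS]/(k * (a s * b s) + a s * b' s) mulrDr mulrCA.
Qed.

Lemma pmul_norm a b : `|pmul a b| <= `|a| * `|b|.
Proof. by rewrite !nrmE -rmorphM lecR; apply/l1n_leP; exact: pmul_sum. Qed.

End Pointwise.

(* The space l1 with its pointwise product *)
Definition Palg (R : realType) (S : choiceType) : Type := l1 R S.

HB.instance Definition _ (R : realType) (S : choiceType) :=
  CompleteNormedModule.copy (Palg R S) (l1 R S).
HB.instance Definition _ (R : realType) (S : choiceType) :=
  isBanachAlgebra.Build R[i] (Palg R S)
    (@pmulA R S) (@pmulPl R S) (@pmulPr R S) (@pmul_norm R S).

Lemma nrm_delta (R : realType) (S : choiceType) (s : S) : nrm (delta s : l1 R S) <= 1.
Proof.
apply/l1n_leP => A.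
have [sA|sA] := boolP (s \in A).
  rewrite (big_rem s)//= eqxx nrm1 big_seq big1 ?addr0// => t.
  rewrite mem_rem_uniq ?fset_uniq// inE => /andP[/negbTE -> _].
  exact: nrm0.
rewrite big_seq big1// => t tA; rewrite /= (_ : t == s = false) ?nrm0//.
by apply: contraNF sA => /eqP <-.
Qed.

Section LiftPhi.
Context {R : realType} {S : choiceType} {W : completeNormedModType R[i]}.
Implicit Types Phi Psi : S -> W.

Lemma eq_lift Phi Psi (a : l1 R S) : Phi =1 Psi -> lift Phi a = lift Psi a.
Proof. by move=> /funext ->. Qed.

Lemma lift_linearl Phi Psi M N (k : R[i]) (a : l1 R S) :
  (forall s, nrm (Phi s) <= M) -> (forall s, nrm (Psi s) <= N) ->
  lift (fun s => k *: Phi s + Psi s) a = k *: lift Phi a + lift Psi a.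
Proof.
move=> PhiM PsiN.
have H s : nrm (k *: Phi s + Psi s) <= nrm k * M + N.
  by rewrite (le_trans (nrmD _ _))// lerD// nrmZ ler_wpM2l ?nrm_ge0.
rewrite -[LHS]/(liftbl H a) -[RHS]/((k *: liftbl PhiM + liftbl PsiN) a).
congr (blfun _ a); apply: l1_ext => s.
rewrite -[RHS]/(k *: lift Phi (delta s) + lift Psi (delta s)) /=.
by rewrite (lift_delta H) (lift_delta PhiM) (lift_delta PsiN).
Qed.

End LiftPhi.

Section Conv.
Context {R : realType} {d : Order.disp_t} {S : meetSemilatticeType d}.
Local Notation l1 := (l1 R S).
Implicit Types a b c : l1.
Import Order.LTheory.

(* The bounded bilinear extension of delta s * delta t = delta (s `&` t),
   see conv_delta and conv_nrm. *)
Definition conv a b : l1 :=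
  lift (fun s => lift (fun t => delta (Order.meet s t)) b) a.

Let inner s t : nrm (delta (Order.meet s t) : l1) <= 1.
Proof. exact: nrm_delta. Qed.

Let outer b s : nrm (lift (fun t => delta (Order.meet s t)) b : l1) <= nrm b.
Proof. by have := lift_nrm (inner s) b; rewrite mul1r. Qed.

Lemma conv_delta s t : conv (delta s) (delta t) = delta (Order.meet s t).
Proof. by rewrite /conv (lift_delta (outer _)) (lift_delta (inner s)). Qed.

Lemma convPl (k : R[i]) a a' b : conv (k *: a + a') b = k *: conv a b + conv a' b.
Proof. exact: (lift_linear (outer b)). Qed.

Lemma convPr (k : R[i]) a b b' : conv a (k *: b + b') = k *: conv a b + conv a b'.
Proof.
rewrite /conv -(lift_linearl _ _ (outer b) (outer b')); apply: eq_lift => s.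
exact: (lift_linear (inner s)).
Qed.

Lemma conv_nrm a b : nrm (conv a b) <= nrm a * nrm b.
Proof. by rewrite mulrC; exact: (lift_nrm (outer b)). Qed.

Lemma conv_norm a b : `|conv a b| <= `|a| * `|b|.
Proof. by rewrite !nrmE -rmorphM lecR conv_nrm. Qed.

Definition convr b : blmap l1 l1 := liftbl (outer b).

Lemma convl_bl a : conv a \in blpred.
Proof. by apply: blpredI (conv_nrm a) => k b b'; exact: convPr. Qed.

Definition convl a : blmap l1 l1 := BL (convl_bl a).

Lemma convA : associative conv.
Proof.
move=> a b c.
rewrite -[LHS]/(convr (conv b c) a) -[RHS]/(blcomp (convr c) (convr b) a).
congr (blfun _ a); apply: l1_ext => s.
rewrite -[LHS]/(blcomp (convl (delta s)) (convr c) b).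
rewrite -[RHS]/(blcomp (convr c) (convl (delta s)) b).
congr (blfun _ b); apply: l1_ext => t.
rewrite -[LHS]/(blcomp (convl (delta s)) (convl (delta t)) c).
rewrite -[RHS]/(convl (conv (delta s) (delta t)) c).
congr (blfun _ c); apply: l1_ext => u /=.
by rewrite !conv_delta meetA.
Qed.

End Conv.

(* The space l1 with the convolution product of S *)
Definition Salg (R : realType) (d : Order.disp_t) (S : meetSemilatticeType d)
  : Type := l1 R S.

HB.instance Definition _ (R : realType) (d : Order.disp_t)
    (S : meetSemilatticeType d) :=
  CompleteNormedModule.copy (Salg R S) (l1 R S).
HB.instance Definition _ (R : realType) (d : Order.disp_t)
    (S : meetSemilatticeType d) :=
  isBanachAlgebra.Build R[i] (Salg R S)
    (@convA R d S) (@convPl R d S) (@convPr R d S) (@conv_norm R d S).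

Section Sch.
Context {R : realType} {d : Order.disp_t} {S : meetSemilatticeType d}.
Implicit Types a b : Salg R S.

Lemma nrm_bool (b : bool) : nrm (b%:R : R[i]) <= 1.
Proof. by case: b; rewrite /= ?nrm1// mulr0n nrm0 ler01. Qed.

Lemma indic_linf (t : S) : (fun y : S => (y <= t)%O%:R : R[i]) \in linfpred.
Proof.
by apply/asboolP; exists 1 => y; exact: nrm_bool.
Qed.

Definition indic (t : S) : linf R S := Linf (indic_linf t).

Lemma nrm_indic t : nrm (indic t) <= 1.
Proof.
by apply/linfn_leP => // y; exact: nrm_bool.
Qed.

(* Characterized by Sch_delta and Sch_uniq *)
Definition Sch : blmap (Salg R S) (linf R S) := liftbl nrm_indic.

Lemma Sch_delta (t y : S) : Sch (delta t) y = (y <= t)%O%:R.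
Proof. by rewrite /= (lift_delta nrm_indic). Qed.

Lemma Sch_uniq (f : blmap (Salg R S) (linf R S)) :
  (forall t y, f (delta t) y = (y <= t)%O%:R) -> f = Sch.
Proof. by move=> fE; apply: l1_ext => t; apply: linfP => y; rewrite fE Sch_delta. Qed.

Lemma Sch_mul a b y : Sch (a ** b) y = Sch a y * Sch b y.
Proof.
have evb : (fun f : linf R S => f y) \in blpred.
  by apply: (@blpredI _ _ _ _ 1) => // f; rewrite mul1r; exact: linfn_eval.
have mulb (z : R[i]) : (fun w : R[i] => w * z) \in blpred.
  apply: (@blpredI _ _ _ _ (nrm z)) => [k w w'|w].
    by rewrite /= mulrDl -mulrA.
  by rewrite nrmM mulrC.
pose ev : dual (linf R S) := BL evb; pose m z := BL (mulb z).
rewrite -[LHS]/(blcomp ev (blcomp Sch (convr b)) a).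
rewrite -[RHS]/(blcomp (m (Sch b y)) (blcomp ev Sch) a).
congr (blfun _ a); apply: l1_ext => s.
rewrite -[LHS]/(blcomp ev (blcomp Sch (convl (delta s))) b).
rewrite -[RHS]/(Sch (delta s) y * Sch b y) mulrC.
rewrite -[RHS]/(blcomp (m (Sch (delta s) y)) (blcomp ev Sch) b).
congr (blfun _ b); apply: l1_ext => t.
rewrite -[LHS]/(Sch (conv (delta s) (delta t)) y).
rewrite -[RHS]/(Sch (delta t) y * Sch (delta s) y) conv_delta !Sch_delta.
by rewrite lexI; do 2!case: (_ <= _)%O; rewrite ?mulr0 ?mulr1.
Qed.

End Sch.

Section ProjectiveTensor.
Context {R : realType}.

Definition bilinear_bounded (X Y W : normedModType R[i])
    (phi : X -> Y -> W) (M : R) : Prop :=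
  [/\ forall y, linear (phi^~ y), forall x, linear (phi x) &
      forall x y, nrm (phi x y) <= M * (nrm x * nrm y)].

(* (T, t) is the projective tensor product of X and Y, with t x y the
   elementary tensor: the universal property for bounded bilinear maps into
   Banach spaces, with control of norms, determines T up to an isometric
   isomorphism compatible with t. *)
Definition is_projective_tensor (X Y T : completeNormedModType R[i])
    (t : X -> Y -> T) : Prop :=
  bilinear_bounded t 1 /\
  forall (W : completeNormedModType R[i]) (phi : X -> Y -> W) (M : R),
    0 <= M -> bilinear_bounded phi M ->
    exists L : blmap T W,
      [/\ forall x y, L (t x y) = phi x y, nrm L <= M &
          forall L' : blmap T W, (forall x y, L' (t x y) = phi x y) -> L' = L].

(* The universal property provides pi and the module actions lact and ract of
   A on T, and makes them unique. The action of a on the second dual of T is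
   the second adjoint of the action of a on T. *)
Definition biflat (A : banachAlgType R[i]) : Prop :=
  exists (T : completeNormedModType R[i]) (t : A -> A -> T),
  is_projective_tensor t /\
  exists (pi : blmap T A) (lact ract : A -> blmap T T),
  [/\ forall a b, pi (t a b) = a ** b,
      forall a b c, lact a (t b c) = t (a ** b) c,
      forall a b c, ract a (t b c) = t b (c ** a) &
      exists sigma : blmap A (dual (dual T)),
      [/\ forall a b, sigma (a ** b) = adjoint (adjoint (lact a)) (sigma b),
          forall a b, sigma (b ** a) = adjoint (adjoint (ract a)) (sigma b) &
          forall a, adjoint (adjoint pi) (sigma a) = kappa A a]].

End ProjectiveTensor.

Definition locally_finite (R : realType) (d : Order.disp_t)
    (S : meetSemilatticeType d) (C : R) : Prop :=
  forall f : S, finite_set [set y : S | (y <= f)%O] /\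
    (#|` fset_set [set y : S | (y <= f)%O]|)%:R <= C.

(* Main.v *)
Require Import Defs.
From mathcomp Require Import all_boot all_order all_algebra.
From mathcomp Require Import complex boolp classical_sets reals ereal normedtype exp.
From mathcomp Require Import finmap cardinality esum.
Set Implicit Arguments.
Unset Strict Implicit.
Unset Printing Implicit Defensive.
Import Order.TTheory GRing.Theory Num.Theory numFieldNormedType.Exports.
Local Open Scope ring_scope.
Local Open Scope complex_scope.

(** For f in S put eps f = (prod_(y < f) (1 - delta y)) ** delta f, of norm at
most 2^(C - 1).  Its Schützenberger transform is delta f, so f |-> eps f
extends to a bounded right inverse of Sch.  It is also a left inverse: by
induction on the size of the down-set of f, the composite T = Sch^-1 o Sch
fixes all delta y with y < f, hence fixes the ideal they generate, and
delta f - eps f lies in that ideal while T (eps f) = eps f.  Consequently the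
eps f are orthogonal idempotents that span a dense subspace, and
eps f |-> eps f (x) eps f extends to a bounded bimodule right inverse of the
product map; here the projective tensor square is l1 (S * S). *)

(** * Bounded linear and bilinear maps *)

Lemma blB (R : realType) (V W : normedModType R[i]) (f : blmap V W) x y :
  f (x - y) = f x - f y.
Proof. exact: linearB. Qed.

Lemma blZ (R : realType) (V W : normedModType R[i]) (f : blmap V W) k x :
  f (k *: x) = k *: f x.
Proof. exact: linearZ. Qed.

Lemma id_bl (R : realType) (V : normedModType R[i]) : (id : V -> V) \in blpred.
Proof. by apply: (@blpredI _ _ _ _ 1) => // x; rewrite mul1r. Qed.

Definition blid (R : realType) (V : normedModType R[i]) : blmap V V :=
  BL (id_bl V).

Section BilinearBounded.
Context {R : realType} {X Y W : normedModType R[i]}.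
Variables (phi : X -> Y -> W) (M : R).
Hypothesis phiM : bilinear_bounded phi M.

Lemma bilinearl_bl y : phi^~ y \in blpred.
Proof.
have [lin _ bnd] := phiM; apply: (blpredI (lin y) (M := M * nrm y)) => x.
by rewrite (le_trans (bnd x y))// [nrm x * _]mulrC mulrA.
Qed.

Lemma bilinearr_bl x : phi x \in blpred.
Proof.
have [_ lin bnd] := phiM; apply: (blpredI (lin x) (M := M * nrm x)) => y.
by rewrite (le_trans (bnd x y))// mulrA.
Qed.

Definition bilinearl y : blmap X W := BL (bilinearl_bl y).
Definition bilinearr x : blmap Y W := BL (bilinearr_bl x).

Lemma bilinear_comp (Z : normedModType R[i]) (L : blmap W Z) :
  bilinear_bounded (fun x y => L (phi x y)) (nrm L * M).
Proof.
have [lin linr bnd] := phiM; split=> [y k x x'|x k y y'|x y].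
- by rewrite -blfun_linear -lin.
- by rewrite -blfun_linear -linr.
- by rewrite (le_trans (bl_eval _ _))// -mulrA ler_wpM2l ?nrm_ge0.
Qed.

Hypothesis M0 : 0 <= M.

Lemma bilinear_compl (Z : normedModType R[i]) (L : blmap Z X) :
  bilinear_bounded (fun z y => phi (L z) y) (M * nrm L).
Proof.
have [lin linr bnd] := phiM; split=> [y k z z'|z k y y'|z y].
- by rewrite blfun_linear -lin.
- by rewrite -linr.
- rewrite (le_trans (bnd _ _))// -mulrA ler_wpM2l// mulrA.
  by rewrite ler_wpM2r ?nrm_ge0 ?bl_eval.
Qed.

Lemma bilinear_compr (Z : normedModType R[i]) (L : blmap Z Y) :
  bilinear_bounded (fun x z => phi x (L z)) (M * nrm L).
Proof.
have [lin linr bnd] := phiM; split=> [z k x x'|x k z z'|x z].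
- by rewrite -lin.
- by rewrite blfun_linear -linr.
- rewrite (le_trans (bnd _ _))// -mulrA ler_wpM2l// mulrCA.
  by rewrite ler_wpM2l ?nrm_ge0 ?bl_eval.
Qed.

End BilinearBounded.

Lemma bmul_bounded (R : realType) (A : banachAlgType R[i]) :
  bilinear_bounded (@bmul R[i] A) 1.
Proof.
split=> [b k a a'|a k b b'|a b]; [exact: bmulPl | exact: bmulPr |].
by rewrite mul1r -lecR rmorphM/= -!nrmE bnormM.
Qed.

(** * Coordinate evaluations and finite combinations of basis vectors *)

Section Evaluation.
Context {R : realType} {S : choiceType}.

Lemma l1_eval_bl (s : S) : (fun a : l1 R S => a s) \in blpred.
Proof.
by apply: (@blpredI _ _ _ _ 1) => // a; rewrite mul1r; exact: l1n_eval.
Qed.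

Lemma linf_eval_bl (s : S) : (fun a : linf R S => a s) \in blpred.
Proof.
by apply: (@blpredI _ _ _ _ 1) => // a; rewrite mul1r; exact: linfn_eval.
Qed.

Lemma sum_delta (F : S -> R[i]) (B : {fset S}) t :
  (\sum_(s <- B) F s *: delta s : l1 R S) t = if t \in B then F t else 0.
Proof.
have -> : (\sum_(s <- B) F s *: delta s) t = \sum_(s <- B) F s * (t == s)%:R.
  by elim/big_ind2 : _ => // x y z w <- <-.
have [tB|tB] := boolP (t \in B).
  rewrite (big_rem t)//= eqxx mulr1 big_seq big1 ?addr0// => s.
  by rewrite mem_rem_uniq ?fset_uniq// inE eq_sym => /andP[/negbTE -> _]; rewrite mulr0.
rewrite big_seq big1// => s sB; rewrite (_ : t == s = false) ?mulr0//.
by apply: contraNF tB => /eqP ->.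
Qed.

End Evaluation.

Lemma pmulC (R : realType) (S : choiceType) : commutative (@pmul R S).
Proof. by move=> a b; apply: l1P => s; exact: mulrC. Qed.

(** * [l1 R (S * U)] as the projective tensor product of [l1 R S] and [l1 R U] *)

Section L1Tensor.
Context {R : realType} {S U : choiceType}.

(** Freezing one variable leaves a bounded linear map, so [l1_ext] applies to each variable in
    turn. *)
Lemma l1_bilinear_ext (W : normedModType R[i]) (phi psi : l1 R S -> l1 R U -> W)
    (M N : R) :
  bilinear_bounded phi M -> bilinear_bounded psi N ->
  (forall s u, phi (delta s) (delta u) = psi (delta s) (delta u)) ->
  forall x y, phi x y = psi x y.
Proof.
move=> phiM psiN E x y.
rewrite -[LHS]/(bilinearl phiM y x) -[RHS]/(bilinearl psiN y x).
congr (blfun _ x); apply: l1_ext => s.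
rewrite -[LHS]/(bilinearr phiM (delta s) y) -[RHS]/(bilinearr psiN (delta s) y).
by congr (blfun _ y); apply: l1_ext => u; exact: E.
Qed.

Section bilift.
Context {W : completeNormedModType R[i]}.
Variables (Phi : S -> U -> W) (M : R).
Hypotheses (M0 : 0 <= M) (PhiM : forall s u, nrm (Phi s u) <= M).

Definition bilift (a : l1 R S) (b : l1 R U) : W :=
  Defs.lift (fun s => Defs.lift (Phi s) b) a.

Let outer b s : nrm (Defs.lift (Phi s) b) <= M * nrm b.
Proof. exact: lift_nrm (PhiM s) b. Qed.

Lemma bilift_delta s u : bilift (delta s) (delta u) = Phi s u.
Proof. by rewrite /bilift (lift_delta (outer _)) (lift_delta (PhiM s)). Qed.

Lemma bilift_bounded : bilinear_bounded bilift M.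
Proof.
split=> [b|a k b b'|a b]; first exact: lift_linear (outer b).
- rewrite /bilift -(lift_linearl _ _ (outer b) (outer b')); apply: eq_lift => s.
  exact: (lift_linear (PhiM s)).
- by rewrite [nrm a * _]mulrC mulrA; exact: (lift_nrm (outer b)).
Qed.

End bilift.

Definition tensor : l1 R S -> l1 R U -> l1 R (S * U)%type :=
  bilift (fun s u => delta (s, u)).

Lemma tensor_delta s u : tensor (delta s) (delta u) = delta (s, u).
Proof. by apply: (bilift_delta (M := 1)) => *; exact: nrm_delta. Qed.

Lemma tensor_bounded : bilinear_bounded tensor 1.
Proof. by apply: bilift_bounded => *; exact: nrm_delta. Qed.

Section tensor_lift.
Context {W : completeNormedModType R[i]}.
Variables (phi : l1 R S -> l1 R U -> W) (M : R).
Hypotheses (M0 : 0 <= M) (phiM : bilinear_bounded phi M).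

Let PhiM (p : S * U) : nrm (phi (delta p.1) (delta p.2)) <= M.
Proof.
have [_ _ bnd] := phiM; rewrite (le_trans (bnd _ _))//.
by rewrite ler_piMr// mulr_ile1 ?nrm_ge0 ?nrm_delta.
Qed.

Definition tensor_lift : blmap (l1 R (S * U)%type) W := liftbl PhiM.

Lemma tensor_liftE x y : tensor_lift (tensor x y) = phi x y.
Proof.
apply: (l1_bilinear_ext (bilinear_comp tensor_bounded tensor_lift) phiM) => s u.
by rewrite tensor_delta; exact: (lift_delta PhiM).
Qed.

Lemma tensor_lift_nrm : nrm tensor_lift <= M.
Proof. by apply/bl_leP => // x; exact: (lift_nrm PhiM). Qed.

End tensor_lift.

(** The factorisation sends [delta (s, u)] to [phi (delta s) (delta u)], of norm at most [M] because
    basis vectors have norm at most 1. It is unique because every basis vector [delta (s, u)] is an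
    elementary tensor. *)
Lemma tensor_projective : is_projective_tensor tensor.
Proof.
split; first exact: tensor_bounded.
move=> W phi M M0 phiM; exists (tensor_lift M0 phiM); split.
- exact: tensor_liftE.
- exact: tensor_lift_nrm.
- move=> L' L'E; apply: l1_ext => -[s u].
  by rewrite -tensor_delta L'E tensor_liftE.
Qed.

End L1Tensor.

(** * Biflatness from a bounded bimodule map into the tensor square *)

Lemma adjoint2_kappa (R : realType) (V W : normedModType R[i]) (f : blmap V W) x :
  adjoint (adjoint f) (kappa V x) = kappa W (f x).
Proof. exact: blP. Qed.

(** Take [kappa T] after [D] as the required map: naturality of [kappa] carries each identity for
    [D] to the second duals. *)
Lemma biflat_diagonal (R : realType) (A : banachAlgType R[i])
    (T : completeNormedModType R[i]) (t : A -> A -> T)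
    (pi : blmap T A) (lact ract : A -> blmap T T) (D : blmap A T) :
  is_projective_tensor t ->
  (forall a b, pi (t a b) = a ** b) ->
  (forall a b c, lact a (t b c) = t (a ** b) c) ->
  (forall a b c, ract a (t b c) = t b (c ** a)) ->
  (forall a b, D (a ** b) = lact a (D b)) ->
  (forall a b, D (b ** a) = ract a (D b)) ->
  (forall a, pi (D a) = a) -> biflat A.
Proof.
move=> projt piE lactE ractE Dl Dr piD.
exists T, t; split=> //; exists pi, lact, ract; split=> //.
have DE a : blcomp (kappa T) D a = kappa T (D a) by [].
exists (blcomp (kappa T) D); split=> [a b|a b|a].
- by rewrite !DE adjoint2_kappa Dl.
- by rewrite !DE adjoint2_kappa Dr.
- by rewrite DE adjoint2_kappa piD.
Qed.

(** * The Schützenberger representation with values in l1 *)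

Section LocallyFinite.
Context {R : realType} {d : Order.disp_t} {S : meetSemilatticeType d}.
Variable C : R.
Hypothesis hS : locally_finite S C.
Local Notation A := (Salg R S).
Local Notation P := (Palg R S).
Implicit Types (f y s t : S) (a b c : A).

(** [fset_set] returns the empty set on infinite sets; [hS] excludes that case. *)
Definition down f : {fset S} := fset_set [set y : S | (y <= f)%O]%classic.

Lemma mem_down f y : (y \in down f) = (y <= f)%O.
Proof. by have [fin _] := hS f; rewrite in_fset_set// mem_setE. Qed.

Lemma card_down f : (#|` down f|)%:R <= C.
Proof. by have [] := hS f. Qed.

(** The indicator of the down-set of [t], written as a finite sum so that it lies in l1 and the
    triangle inequality bounds its norm by [C]. *)
Definition down_sum t : P := \sum_(y <- down t) delta y.

Lemma down_sumE t y : down_sum t y = (y <= t)%O%:R.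
Proof.
rewrite /down_sum (eq_bigr (fun s => 1 *: delta s)) => [|s _]; last by rewrite scale1r.
by rewrite sum_delta mem_down; case: (_ <= _)%O.
Qed.

Lemma nrm_down_sum t : nrm (down_sum t) <= C.
Proof.
apply: le_trans (card_down t); rewrite (le_trans (nrm_sum _ _))//.
rewrite -sum1_size natr_sum; apply: ler_sum => s _; exact: nrm_delta.
Qed.

Definition SchP : blmap A P := liftbl nrm_down_sum.

Lemma SchP_delta t : SchP (delta t) = down_sum t.
Proof. exact: (lift_delta nrm_down_sum). Qed.

Lemma SchPE a s : SchP a s = Sch a s.
Proof.
pose f : blmap P R[i] := BL (l1_eval_bl s).
pose g : blmap (linf R S) R[i] := BL (linf_eval_bl s).
rewrite -[LHS]/(blcomp f SchP a) -[RHS]/(blcomp g Sch a).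
congr (blfun _ a); apply: l1_ext => t.
rewrite -[LHS]/(SchP (delta t) s) -[RHS]/(Sch (delta t) s).
by rewrite SchP_delta down_sumE Sch_delta.
Qed.

Lemma SchP_nrm a : nrm (SchP a) <= C * nrm a.
Proof. exact: (lift_nrm nrm_down_sum). Qed.

Lemma SchP_mul a b : SchP (a ** b) = SchP a ** SchP b.
Proof. by apply: l1P => s; rewrite SchPE Sch_mul -!SchPE. Qed.

(** * The elements [eps f] and the right inverse *)

(** Multiplication by [1 - delta y], expressed without a unit since the algebra need not have
    one. *)
Definition compl_mul y a : A := a - (delta y : A) ** a.

Lemma compl_mul_nrm y a : nrm (compl_mul y a) <= 2 * nrm a.
Proof.
rewrite (le_trans (nrmD _ _))// nrmN mulrDl mul1r lerD2l.
rewrite (le_trans (conv_nrm _ _))// ler_piMl ?nrm_ge0//; exact: nrm_delta.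
Qed.

Lemma SchP_compl_mul y a s :
  SchP (compl_mul y a) s = (~~ (s <= y)%O)%:R * SchP a s.
Proof.
rewrite /compl_mul blB SchP_mul.
rewrite -[LHS]/(SchP a s - SchP (delta y) s * SchP a s) SchP_delta down_sumE.
by case: (_ <= _)%O; rewrite /= ?mul0r ?mul1r ?subr0 ?subrr.
Qed.

Definition eps f : A := foldr compl_mul (delta f) (down f `\ f)%fset.

Lemma nrm_eps f : nrm (eps f) <= 2 `^ (C - 1).
Proof.
have H (l : seq S) : nrm (foldr compl_mul (delta f) l) <= 2 ^+ size l.
  elim: l => [|y l ih] /=; first exact: nrm_delta.
  by rewrite (le_trans (compl_mul_nrm _ _))// exprS ler_pM2l.
rewrite (le_trans (H _))// -powR_mulrn// ler_powR ?ler1n//.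
(* Each factor at most doubles the norm; as [f] lies in its own down-set, at most [C - 1] factors
   remain after removing it. *)
have fd : f \in down f by rewrite mem_down.
by rewrite lerBrDr natr1 (le_trans _ (card_down f))// (cardfsD1 f) fd.
Qed.

Lemma SchP_eps f : SchP (eps f) = delta f.
Proof.
(* Each factor [1 - delta y] multiplies the transform by the indicator of the complement of the
   down-set of [y]. *)
have E l s : SchP (foldr compl_mul (delta f) l) s =
    ((s <= f)%O && all (fun y => ~~ (s <= y)%O) l)%:R.
  elim: l => [|y l ih].
    by rewrite -[LHS]/(SchP (delta f) s) andbT SchP_delta down_sumE.
  rewrite -[LHS]/(SchP (compl_mul y (foldr compl_mul (delta f) l)) s).
  by rewrite SchP_compl_mul ih -natrM mulnb andbCA.
apply: l1P => s; rewrite E -[RHS]/((s == f)%:R).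
congr (_%:R); congr nat_of_bool; apply/idP/eqP => [/andP[sf /allP H]|->].
  (* If [s < f], then [s] itself occurs in the list, and its own factor vanishes at [s]. *)
  apply: contraTeq sf => sf; apply/negP => sf'.
  by have := H s; rewrite !inE sf mem_down sf' lexx => /(_ isT).
(* At [f] no factor vanishes: [f <= y <= f] would force [y = f]. *)
rewrite lexx/=; apply/allP => y; rewrite !inE mem_down => /andP[yf yf'].
by apply: contra yf => fy; rewrite eq_le yf'.
Qed.

Definition SchPinv : blmap P A := liftbl nrm_eps.

Lemma SchPinv_delta f : SchPinv (delta f) = eps f.
Proof. exact: (lift_delta nrm_eps). Qed.

Lemma SchPinvK : cancel SchPinv SchP.
Proof.
move=> b; rewrite -[LHS]/(blcomp SchP SchPinv b).
rewrite -[RHS]/(blid _ b); congr (blfun _ b); apply: l1_ext => f /=.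
by rewrite -[LHS]/(SchP (SchPinv (delta f))) SchPinv_delta SchP_eps.
Qed.

Lemma SchPinv_nrm b : nrm (SchPinv b) <= 2 `^ (C - 1) * nrm b.
Proof. exact: (lift_nrm nrm_eps). Qed.

(** * The left inverse *)

Lemma SchPK_delta f : SchPinv (SchP (delta f)) = delta f.
Proof.
have [n] := ubnP (#|` down f|); elim: n f => // n ih f; rewrite ltnS => fn.
pose T : blmap A A := blcomp SchPinv SchP.
(* By density take [a = delta t]: the product is the basis vector at the meet of [y] and [t], which
   lies strictly below [f], so the induction hypothesis applies. *)
have Ty y a : (y < f)%O -> T ((delta y : A) ** a) = (delta y : A) ** a.
  move=> yf; rewrite -[LHS]/(blcomp T (convl (delta y)) a).
  rewrite -[RHS]/(convl (delta y) a); congr (blfun _ a); apply: l1_ext => t.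
  rewrite -[LHS]/(T (conv (delta y) (delta t))) /= conv_delta; apply: ih.
  apply: leq_trans fn; apply: fproper_ltn_card.
  have yt : (Order.meet y t < f)%O by apply: le_lt_trans (leIl _ _) yf.
  rewrite fproperE; apply/andP; split.
    by apply/fsubsetP => z; rewrite !mem_down => /le_trans; apply; exact: ltW.
  by apply/negP => /fsubsetP/(_ f); rewrite !mem_down lexx lt_geF// => /(_ isT).
(* Each factor subtracts some [delta y ** u] with [y < f], which [T] fixes, so the defect [T x - x]
   does not change. *)
have Tfold (l : seq S) : {in l, forall y, (y < f)%O} ->
    T (foldr compl_mul (delta f) l) - foldr compl_mul (delta f) l = T (delta f) - delta f.
  elim: l => [//|y l ihl H].
  apply: etrans (ihl _) => [|z zl]; last by apply: H; rewrite inE zl orbT.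
  set u := foldr _ _ l.
  rewrite -[LHS]/(T (compl_mul y u) - compl_mul y u) /compl_mul blB.
  by rewrite Ty ?H ?mem_head// opprB addrA subrK.
have : T (eps f) - eps f = T (delta f) - delta f.
  by apply: Tfold => y; rewrite !inE mem_down lt_neqAle.
(* The defect of [eps f] is zero, hence so is that of [delta f]. *)
rewrite -[T (eps f)]/(SchPinv (SchP (eps f))) SchP_eps SchPinv_delta subrr.
by move=> /esym/eqP; rewrite subr_eq0 => /eqP.
Qed.

Lemma SchPK : cancel SchP SchPinv.
Proof.
move=> b; rewrite -[LHS]/(blcomp SchPinv SchP b).
rewrite -[RHS]/(blid _ b); congr (blfun _ b); apply: l1_ext => f.
exact: SchPK_delta.
Qed.

(** * The [eps f] as simultaneous eigenvectors *)

(** Under the injective homomorphism [SchP] this is the pointwise product with [delta f], which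
    keeps only the coordinate at [f]. *)
Lemma mul_eps a f : a ** eps f = SchP a f *: eps f.
Proof.
apply: (can_inj SchPK); rewrite SchP_mul SchP_eps.
rewrite blZ SchP_eps.
apply: l1P => s; rewrite -[LHS]/(SchP a s * (s == f)%:R).
rewrite -[RHS]/(SchP a f * (s == f)%:R).
by have [->//|_] := eqVneq s f; rewrite !mulr0.
Qed.

Lemma mulC a b : a ** b = b ** a.
Proof.
apply: (can_inj SchPK).
exact: etrans (SchP_mul a b) (etrans (pmulC _ _) (esym (SchP_mul b a))).
Qed.

(** Since [SchPinv] is onto and maps [delta f] to [eps f], the [eps f] inherit the density property
    of the basis. *)
Lemma eps_ext (W : normedModType R[i]) (g h : blmap A W) :
  (forall f, g (eps f) = h (eps f)) -> forall a, g a = h a.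
Proof.
move=> gh a; rewrite -[a]SchPK.
move: (SchP a) => b.
rewrite -[LHS]/(blcomp g SchPinv b) -[RHS]/(blcomp h SchPinv b).
congr (blfun _ b); apply: l1_ext => f.
rewrite -[LHS]/(g (SchPinv (delta f))) -[RHS]/(h (SchPinv (delta f))).
by rewrite SchPinv_delta.
Qed.

(** * The bimodule structure of the tensor square and the diagonal map *)

Let tensor_bounded' : bilinear_bounded (@tensor R S S : A -> A -> l1 R (S * S)%type) 1.
Proof. exact: tensor_bounded. Qed.

Let lmul a : blmap A A := bilinearr (@bmul_bounded R A) a.
Let rmul a : blmap A A := bilinearl (@bmul_bounded R A) a.

Definition lact a : blmap (l1 R (S * S)%type) (l1 R (S * S)%type) :=
  tensor_lift (mulr_ge0 ler01 (nrm_ge0 (lmul a)))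
    (bilinear_compl tensor_bounded' ler01 (lmul a)).

Definition ract a : blmap (l1 R (S * S)%type) (l1 R (S * S)%type) :=
  tensor_lift (mulr_ge0 ler01 (nrm_ge0 (rmul a)))
    (bilinear_compr tensor_bounded' ler01 (rmul a)).

Definition pi : blmap (l1 R (S * S)%type) A :=
  tensor_lift ler01 (@bmul_bounded R A).

Lemma lactE a b c : lact a (tensor b c) = tensor (a ** b) c.
Proof. exact: tensor_liftE. Qed.

Lemma ractE a b c : ract a (tensor b c) = tensor b (c ** a).
Proof. exact: tensor_liftE. Qed.

Lemma piE a b : pi (tensor a b) = a ** b.
Proof. exact: tensor_liftE. Qed.

Lemma nrm_eps2 f : nrm (tensor (eps f) (eps f)) <= 2 `^ (C - 1) * 2 `^ (C - 1).
Proof.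
have [_ _ bnd] := @tensor_bounded R S S.
rewrite (le_trans (bnd _ _))// mul1r ler_pM ?nrm_ge0//; exact: nrm_eps.
Qed.

(** The numbers [SchP a f] are the coordinates of [a] along the [eps f]; the map replaces each
    [eps f] by its tensor square. *)
Definition diag : blmap A (l1 R (S * S)%type) := blcomp (liftbl nrm_eps2) SchP.

Lemma diag_eps f : diag (eps f) = tensor (eps f) (eps f).
Proof.
by rewrite -[LHS]/(liftbl nrm_eps2 (SchP (eps f))) SchP_eps; exact: lift_delta nrm_eps2 f.
Qed.

(** At [b = eps f] both sides are [SchP a f] times the tensor square of [eps f], by [mul_eps]. *)
Lemma diag_lact a b : diag (a ** b) = lact a (diag b).
Proof.
rewrite -[LHS]/(blcomp diag (lmul a) b) -[RHS]/(blcomp (lact a) diag b).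
apply: eps_ext => f.
rewrite -[LHS]/(diag (a ** eps f)) -[RHS]/(lact a (diag (eps f))).
rewrite diag_eps lactE mul_eps blZ diag_eps.
by rewrite -[RHS]/(bilinearl tensor_bounded' (eps f) (SchP a f *: eps f)) blZ.
Qed.

Lemma diag_ract a b : diag (b ** a) = ract a (diag b).
Proof.
rewrite -[LHS]/(blcomp diag (rmul a) b) -[RHS]/(blcomp (ract a) diag b).
apply: eps_ext => f.
rewrite -[LHS]/(diag (eps f ** a)) -[RHS]/(ract a (diag (eps f))).
(* Commutativity turns the right action on [eps f] into the left one. *)
rewrite diag_eps ractE mulC mul_eps blZ diag_eps.
by rewrite -[RHS]/(bilinearr tensor_bounded' (eps f) (SchP a f *: eps f)) blZ.
Qed.

Lemma pi_diag a : pi (diag a) = a.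
Proof.
rewrite -[LHS]/(blcomp pi diag a) -[RHS]/(blid _ a); apply: eps_ext => f.
(* The product map returns [eps f ** eps f], and [eps f] is idempotent because [SchP (eps f)] is 1
   at [f]. *)
rewrite -[LHS]/(pi (diag (eps f))) diag_eps piE mul_eps SchP_eps.
by rewrite -[_ f]/((f == f)%:R) eqxx scale1r.
Qed.

Lemma biflat_Salg : biflat A.
Proof.
apply: (@biflat_diagonal R A _ (@tensor R S S) pi lact ract diag).
- exact: tensor_projective.
- exact: piE.
- exact: lactE.
- exact: ractE.
- exact: diag_lact.
- exact: diag_ract.
- exact: pi_diag.
Qed.

End LocallyFinite.

Theorem theorem5p5 (R : realType) (d : Order.disp_t)
    (S : meetSemilatticeType d) (C : R) (hC : 1 <= C)
    (hS : locally_finite S C) :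
  [/\ forall a : Salg R S, (l1norm (Sch a) <= (C * nrm a)%:E)%E,
      exists (SchP : blmap (Salg R S) (Palg R S))
             (SchPinv : blmap (Palg R S) (Salg R S)),
        [/\ forall a s, SchP a s = Sch a s,
            cancel SchP SchPinv, cancel SchPinv SchP &
            forall b, nrm (SchPinv b) <= 2 `^ (C - 1) * nrm b] &
      biflat (Salg R S)].
Proof.
split.
- move=> a; have -> : (Sch a : S -> R[i]) = SchP hS a.
    by apply/funext => s; rewrite SchPE.
  by rewrite -l1_nrmEe lee_fin; exact: SchP_nrm.
- exists (SchP hS), (SchPinv hS); split; [exact: SchPE | exact: SchPK | exact: SchPinvK | exact: SchPinv_nrm].
- exact: biflat_Salg hS.
Qed.
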